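(* Let $X\subset Y$ be Banach spaces with $X$ compactly embedded into $Y$, let $\mathcal{A}:Y\to X$ be a continuous operator, and let $u\in X$ satisfy $\mathcal{A}[u]=u$ in $X$. Let $h_\infty\in\mathbb{R}$ or $h_\infty=\pm\infty$, and for each value of the parameter $h$ let $X_h$ be a subspace of $X$ and $\mathcal{A}_h:Y\to X_h$ a continuous operator. Let $\mathcal{I}$ be the identity operator on $X$. Suppose the following three conditions hold. (1) $\mathcal{A}$ is Fréchet-differentiable at $u$ and the Fréchet derivative $\mathcal{A}'[u]:Y\to X$ is a bounded linear operator defined via the limit $$\lim_{\|v-u\|_Y\to 0}\frac{\|\mathcal{A}[v]-\mathcal{A}[u]-\mathcal{A}'[u](v-u)\|_X}{\|v-u\|_Y}=0.$$ (2) There exists an $r>0$ such that $\mathcal{I}-\mathcal{A}'[u]$ restricted on $B(u,r)$ has a bounded inverse, namely, there exist two constants $M_0$ and $M_1$ such that $$\sup_{0\ne v\in B(u,r)}\frac{\|(\mathcal{I}-\mathcal{A}'[u])v\|_X}{\|v\|_X}\le M_0,\qquad \sup_{0\ne v\in B(u,r)}\frac{\|v\|_X}{\|(\mathcal{I}-\mathcal{A}'[u])v\|_X}\le M_1.$$ (3) $\mathcal{A}_h$ has the local approximation property $$\lim_{h\to h_\infty}\epsilon(h)=0,\qquad\text{where}\quad \epsilon(h):=\sup_{v\in B(u,r)}\|\mathcal{A}_h[v]-\mathcal{A}[v]\|_X.$$ Then there exist an $r_0\in\big(0,(1+M_0M_1)^{-1}r\big]$ and an $h_0\in\mathbb{R}$,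 $h_0\neq h_\infty$, such that, for any $h$ between $h_0$ and $h_\infty$, the problem $\mathcal{A}_h[u_h]=u_h$ in $X_h$ has a solution $u_h\in B(u,r_0)$ which satisfies $$\|u_h-u\|_X\le 2M_1\|\mathcal{A}_h[u_h]-\mathcal{A}[u_h]\|_X\le(1+2M_0M_1)\|u_h-u\|_X.$$
   Context: For $u\in X$ and $r>0$, $B(u,r)=\{w\in X:\|w-u\|_X\le r\}$ denotes the closed ball of $X$ with center $u$ and radius $r$. The operators $\mathcal{A}$ and $\mathcal{A}_h$ are in general nonlinear.
   Formalization: In condition (2), v is read as a displacement from u: the suprema run over v ≠ 0 with u+v in B(u,r), i.e. 0 < ‖v‖ ≤ r, because with v itself in B(u,r) the claim fails when ‖u‖ > r; M_0 and M_1 are taken nonnegative. *)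

(* Defs.v *)
From HB Require Import structures.
From mathcomp Require Import all_boot all_order all_algebra.
From mathcomp Require Import all_classical all_reals all_analysis.

Set Implicit Arguments.
Unset Strict Implicit.
Unset Printing Implicit Defensive.

Import Order.TTheory GRing.Theory Num.Theory.
Import numFieldNormedType.Exports.

Local Open Scope classical_set_scope.
Local Open Scope ring_scope.

(* The inclusion of X into Y is represented by an injective linear map. *)
Definition compact_embedding (R : realType) (X Y : normedModType R)
    (iota : {linear X -> Y}) : Prop :=
  [/\ injective iota, continuous iota &
      forall B : set X, bounded_set B -> precompact (iota @` B)].

(* At a finite point the neighbourhoods are deleted: the operators with index
   h_oo itself play no role. *)
Definition param_nbhs (R : realType) (hoo : \bar R) : set_system R :=
  match hoo with
  | r%:E%E => r^'
  | +oo%E => pinfty_nbhs R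
  | -oo%E => ninfty_nbhs R
  end.

Definition between (R : realType) (h0 hoo : \bar R) (h : R) : Prop :=
  (h0 < h%:E < hoo)%E \/ (hoo < h%:E < h0)%E.

(* The supremum is extended-real valued, hence +oo when the discrepancy is
   unbounded on the ball. *)
Definition local_error (R : realType) (X Y : normedModType R) (iota : X -> Y)
    (A Ah : Y -> X) (u : X) (r : R) : \bar R :=
  ereal_sup [set `|Ah (iota v) - A (iota v)|%:E
            | v in closed_ball_ (@Num.norm R X) u r].

(* Extended-real division is used so that 0 in the denominator gives +oo; in R
   the quotient would be 0 and a kernel of D would go unnoticed.
   The ball is centred at u and w is the displacement from u: for a bound over
   nonzero points v of the ball itself, a ball avoiding 0 would not control
   I - A'[u] in all directions, so that it could have a kernel. *)
Definition sup_ratio (R : realType) (X : normedModType R) (N D : X -> X)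
    (u : X) (r : R) : \bar R :=
  ereal_sup [set (`|N w|%:E / `|D w|%:E)%E
            | w in [set w | w != 0 /\ closed_ball_ (@Num.norm R X) u r (u + w)]].

(* Main.v *)
(**
Write K for the compact operator A'[u] o iota on X. Since I - K is bounded
below, the Riesz theory of compact operators makes it bijective, with an inverse
S that is M1-Lipschitz. The solutions of A_h[v] = v are the fixed points of
T v = S (A_h[v] - K v), and T v - u is the image under S of
(A_h[v] - A[v]) + (A[v] - A[u] - K (v - u)), where the first term is at most
epsilon(h) and the second is o(|v - u|). Hence T maps a small closed ball around
u into itself, with a relatively compact range because X embeds compactly in Y,
and Schauder's theorem gives u_h. The same decomposition at v = u_h gives the
two-sided estimate.

Schauder's theorem is reduced by finite nets and partitions of unity to
Brouwer's theorem on a simplex, which is obtained from Scarf's combinatorial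
lemma: for a colored finite set with one linear order per color, some subset D
is such that no point exceeds all of D in every order whose color occurs in D.
On the grid of mesh 1/k of the simplex, ordered by coordinates, such a set has
diameter O(1/k), and points are colored by a coordinate that the map does not
decrease.
*)
Require Import Defs.
From HB Require Import structures.
From mathcomp Require Import all_boot all_order all_algebra.
From mathcomp Require Import zify ring lra.

Set Implicit Arguments.
Unset Strict Implicit.
Unset Printing Implicit Defensive.

(** * Scarf's lemma *)

(** Only the fiber over [y0] can affect the parity. Incidences of cells and doors are counted this
    way twice, by cells and by doors. *)
Lemma odd_card_fibers (T V : finType) (A : {set T}) (f : T -> V) (y0 : V) :
  (forall y, y != y0 -> ~~ odd #|[set x in A | f x == y]|) ->
  odd #|A| = odd #|[set x in A | f x == y0]|.
Proof.
move=> ev; rewrite -sum1_card (partition_big f xpredT) //= (bigD1 y0) //=.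
have -> : \sum_(x in A | f x == y0) 1 = #|[set x in A | f x == y0]|.
  by rewrite -sum1_card; apply: eq_bigl => x; rewrite inE.
rewrite oddD; set s := (X in _ (+) odd X); suff /negbTE-> : ~~ odd s by rewrite addbF.
rewrite /s; apply: (big_ind (fun n => ~~ odd n)) => // [m n hm hn|y hy].
  by rewrite oddD (negbTE hm) (negbTE hn).
suff -> : \sum_(x in A | f x == y) 1 = #|[set x in A | f x == y]| by exact: ev.
by rewrite -sum1_card; apply: eq_bigl => x; rewrite inE.
Qed.

Section DominantSets.
Variables (U I : finType) (v : I -> U -> nat).
Hypothesis vI : forall i, injective (v i).

(** No point lies above the minimum of [S] in all orders at once. Dominant sets play the role of the
    simplices of a triangulation. *)
Definition dominant (S : {set U}) :=
  [forall y, exists i, forall s in S, v i y <= v i s].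

Lemma dominantP (S : {set U}) :
  reflect (forall y, exists i, forall s, s \in S -> v i y <= v i s) (dominant S).
Proof.
apply: (iffP forallP) => h y; first by have /existsP[i /forall_inP] := h y; exists i.
by have [i hi] := h y; apply/existsP; exists i; apply/forall_inP.
Qed.

Lemma dominantS (S T : {set U}) : S \subset T -> dominant T -> dominant S.
Proof.
move=> /subsetP ST /dominantP dT; apply/dominantP => y.
by have [i hi] := dT y; exists i => s /ST /hi.
Qed.

(** When [S] is dominant, order [i] is then the only possible witness of dominance at [y]. *)
Definition beats (S : {set U}) (i : I) (y : U) :=
  [forall k, (k != i) ==> [exists s in S, v k s < v k y]].

Lemma beatsP (S : {set U}) i y :
  reflect (forall k, k != i -> exists2 s, s \in S & v k s < v k y) (beats S i y).
Proof.
apply: (iffP forallP) => h k.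
  by move=> ki; have /implyP/(_ ki)/exists_inP := h k.
by apply/implyP => /h ?; apply/exists_inP.
Qed.

Lemma exists_min (S : {set U}) : S != set0 ->
  exists m : I -> U, forall i, m i \in S /\ forall s, s \in S -> v i (m i) <= v i s.
Proof.
case/set0Pn=> s0 s0S.
exists (fun i => [arg min_(s < s0 | s \in S) v i s]) => i.
by case: arg_minnP.
Qed.

(** By dominance each element of [x |: S] is the minimum in some order; there are as many elements
    as orders, so this matching is bijective. The order [i] is the one whose minimum is [x]. *)
Lemma dominant_ext (S : {set U}) x (D : dominant (x |: S)) (xS : x \notin S)
    (cS : #|S|.+1 = #|I|) :
  exists2 i, beats S i x &
    (forall s, s \in S -> v i x <= v i s) /\ (forall y, beats S i y -> v i y <= v i x).
Proof.
have [|m hm] := @exists_min (x |: S); first by apply/set0Pn; exists x; rewrite setU11.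
have msurj s : s \in x |: S -> exists i, m i = s.
  move=> sS; have [i hi] := dominantP _ D s; exists i; apply: (@vI i); apply/eqP.
  by rewrite eqn_leq (hm i).2 //= hi // (hm i).1.
have minj : injective m.
  have e : m @: [set: I] = x |: S.
    apply/setP => s; apply/imsetP/idP => [[i _ ->]|/msurj[i <-]]; first exact: (hm i).1.
    by exists i.
  have/imset_injP inj : #|m @: [set: I]| == #|[set: I]|.
    by rewrite e cardsU1 xS cardsT add1n cS.
  by move=> i j ij; apply: inj; rewrite ?inE.
have [i mi] := msurj x (setU11 _ _).
exists i.
  apply/beatsP => k ki; have mk : m k != x by rewrite -mi (inj_eq minj).
  have [] := hm k; rewrite !inE (negbTE mk) /= => mkS hk; exists (m k) => //.
  rewrite ltn_neqAle hk ?setU11 // andbT.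
  by rewrite (inj_eq (@vI k)).
split=> [s sS|y /beatsP by_]; first by rewrite -mi (hm i).2 // inE sS orbT.
have [k hk] := dominantP _ D y.
have [<-|ki] := eqVneq k i; first by rewrite hk // setU11.
have [s sS] := by_ _ ki; rewrite ltnNge hk // inE sS orbT //.
Qed.

(** Points that beat [S] outside [i] are witnessed in order [i], by maximality of [x]. Any other
    point has a witness [k != i], where [x] exceeds some element of [S] and does not lower the
    minimum. *)
Lemma ext_dominant (S : {set U}) x i : beats S i x ->
    (forall s, s \in S -> v i x <= v i s) -> (forall y, beats S i y -> v i y <= v i x) ->
  dominant (x |: S).
Proof.
move=> /beatsP xS xl xM; apply/dominantP => y.
have [yb|] := boolP (beats S i y).
  exists i => s; rewrite !inE => /orP[/eqP->|/xl]; first exact: xM.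
  by apply: leq_trans; exact: xM.
rewrite negb_forall => /existsP[k]; rewrite negb_imply => /andP[ki].
rewrite negb_exists => /forallP h; exists k => s.
have {}h t : t \in S -> v k y <= v k t by move=> tS; have := h t; rewrite tS -leqNgt.
rewrite !inE => /orP[/eqP->|/h//].
by have [t tS /ltnW] := xS _ ki; apply: leq_trans; exact: h.
Qed.

(* [S] has one element less than [I], so minimisation over [S] identifies
   exactly one pair of indices, and the two elements that can be added to [S]
   are obtained by freeing either of them. *)
Lemma card_dominant_ext (S : {set U}) : dominant S -> S != set0 -> #|S|.+1 = #|I| ->
    (forall i, exists y, beats S i y) ->
  #|[set x | (x \notin S) && dominant (x |: S)]| = 2.
Proof.
move=> D S0 cS bex; have [m hm] := exists_min S0.
have msurj s : s \in S -> exists i, m i = s.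
  move=> sS; have [i hi] := dominantP _ D s; exists i; apply: (@vI i); apply/eqP.
  by rewrite eqn_leq (hm i).2 //= hi // (hm i).1.
have mimg : m @: [set: I] = S.
  apply/setP => s; apply/imsetP/idP => [[i _ ->]|/msurj[i <-]]; first exact: (hm i).1.
  by exists i.
have [i [j [ij mij minj]]] : exists i j, [/\ i != j, m i = m j &
    forall k l, k != i -> l != i -> m k = m l -> k = l].
  have /injectivePn[i [j ij mij]] : ~~ injectiveb m.
    apply/injectiveP => inj; have := card_imset [set: I] inj.
    by rewrite mimg cardsT -cS => /eqP; rewrite ltn_eqF.
  exists i, j; split=> //.
  have e : m @: [set~ i] = S.
    rewrite -mimg; apply/setP => s; apply/imsetP/imsetP => -[k hk ->]; first by exists k.
    have [->|ki] := eqVneq k i; first by exists j => //; rewrite !inE eq_sym.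
    by exists k => //; rewrite !inE.
  have/imset_injP inj : #|m @: [set~ i]| == #|[set~ i]| by rewrite e cardsC1 -cS.
  by move=> k l ki li kl; apply: inj; rewrite ?inE.
have beat_min k y l : beats S k y -> l != k -> v l (m l) < v l y.
  by move=> /beatsP h /h[s /(hm l).2]; exact: leq_ltn_trans.
have maxex k : exists2 x, beats S k x & forall y, beats S k y -> v k y <= v k x.
  have [y0 hy0] := bex k.
  by exists [arg max_(y > y0 | beats S k y) v k y]; case: arg_maxnP.
have below k x : beats S k x -> forall s, s \in S -> v k x <= v k s.
  move=> bx; have [l hl] := dominantP _ D x.
  have [<-//|lk] := eqVneq l k.
  by have := beat_min _ _ _ bx lk; rewrite ltnNge hl // (hm l).1.
have notin k k' x : k != k' -> m k = m k' -> beats S k x -> x \notin S.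
  move=> kk' mk bx; apply/negP => xS.
  have := beat_min _ _ k' bx; rewrite eq_sym => /(_ kk'); rewrite -mk.
  suff -> : x = m k by rewrite ltnn.
  apply: (@vI k); apply/eqP; rewrite eqn_leq (hm k).2 // andbT.
  by apply: below bx _ _; exact: (hm k).1.
(* The two extensions are the highest points beating [S] outside [i] and outside [j]. *)
have [xi bi maxi] := maxex i; have [xj bj maxj] := maxex j.
have xij : xi != xj.
  apply/eqP => e; have := beat_min _ _ j bi; rewrite eq_sym => /(_ ij).
  by rewrite e ltnNge (below j) // (hm j).1.
suff -> : [set x | (x \notin S) && dominant (x |: S)] = [set xi; xj].
  by rewrite cards2 xij.
apply/setP => x; rewrite !inE; apply/andP/orP.
  case=> xS xD; have [k bk [lk maxk]] := dominant_ext xD xS cS.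
  have [ki|ki] := eqVneq k i.
    left; apply/eqP; apply: (@vI i); apply/eqP; rewrite ki in bk maxk.
    by rewrite eqn_leq maxi //= maxk.
  have [kj|kj] := eqVneq k j.
    right; apply/eqP; apply: (@vI j); apply/eqP; rewrite kj in bk maxk.
    by rewrite eqn_leq maxj //= maxk.
  (* [x] takes the index [k] away from [m k], which no other index selects, so
     [m k] would be minimal in [x |: S] for no index at all. *)
  have [l hl] := dominantP _ xD (m k).
  have lk' : l != k.
    apply/eqP => lk'; have := hl x; rewrite setU11 => /(_ isT); rewrite lk' => h.
    have : m k = x by apply: (@vI k); apply/eqP; rewrite eqn_leq h lk ?(hm k).1.
    by move=> e; move: xS; rewrite -e (hm k).1.
  have e : m l = m k.
    apply: (@vI l); apply/eqP; rewrite eqn_leq (hm l).2 ?(hm k).1 //= hl //.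
    by rewrite inE (hm l).1 orbT.
  have [li|li] := eqVneq l i.
    by case/eqP: kj; apply: (minj _ _ ki); rewrite 1?eq_sym // -mij -li e.
  by case/eqP: lk'; exact: minj.
case=> /eqP ->.
  by split; [exact: notin ij mij bi | exact: ext_dominant bi (below _ _ bi) maxi].
by split; [apply: notin bj; [rewrite eq_sym; exact: ij|] | exact: ext_dominant bj (below _ _ bj) maxj].
Qed.

(* [b i] encodes the absence of the color [i]: a pair (set of points, set of
   colors) becomes a single subset of [U]. *)
Variables (c : U -> I) (b : I -> U) (u0 : U).
Hypothesis b_bottom : forall i u, v i (b i) <= v i u.
Hypothesis b_top : forall i j u, j != i -> (forall k, u != b k) -> v i u < v i (b j).
Hypothesis cb : forall i, c (b i) = i.
Hypothesis u0b : forall k, u0 != b k.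

(** In an order [k != i0] the minimum of [S] is the global bottom [b k], so a point other than the
    [b k] can only be witnessed in order [i0]. The extension is the highest such point in that
    order; [u0] shows that one exists. *)
Lemma card_dominant_ext_bottom (i0 : I) (S := b @: [set~ i0]) :
  #|[set x | (x \notin S) && dominant (x |: S)]| = 1.
Proof.
pose P := [pred u | [forall k, u != b k]].
have Pu0 : P u0 by apply/forallP.
have [x /forallP xP xmax] : exists2 x, P x & forall y, P y -> v i0 y <= v i0 x.
  by exists [arg max_(y > u0 | P y) v i0 y]; case: arg_maxnP.
have bS k : k != i0 -> b k \in S by move=> ki; apply: imset_f; rewrite !inE.
suff -> : [set x | (x \notin S) && dominant (x |: S)] = [set x] by rewrite cards1.
have key y i (T : {set U}) : P y -> S \subset T -> (forall s, s \in T -> v i y <= v i s) -> i = i0.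
  move=> yP /subsetP ST h; apply/eqP; apply/negPn/negP => ii0.
  have /forallP/(_ i)/eqP := yP; apply; apply: (@vI i); apply/eqP.
  by rewrite eqn_leq b_bottom andbT; apply/h/ST/bS.
apply/setP => z; rewrite !inE; apply/andP/eqP => [[zS zD]|->].
  have maxz y : P y -> v i0 y <= v i0 z.
    move=> yP; have [i hi] := dominantP _ zD y.
    by rewrite -(key _ _ _ yP _ hi) ?subsetUr // hi // setU11.
  apply: (@vI i0); apply/eqP; rewrite eqn_leq maxz; last exact/forallP.
  rewrite xmax //; apply/forallP => k; apply/eqP => zk.
  have [ki|ki] := eqVneq k i0; last by rewrite zk bS in zS.
  have e : u0 = b i0.
    have h := maxz _ Pu0; rewrite zk ki in h.
    by apply: (@vI i0); apply/eqP; rewrite eqn_leq b_bottom h.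
  by have := u0b i0; rewrite e eqxx.
split; first by apply/imsetP => -[k _ e]; have := xP k; rewrite e eqxx.
apply/dominantP => y; have [yP|] := boolP (P y).
  exists i0 => s; rewrite !inE => /orP[/eqP->|]; first exact: xmax.
  by move=> /imsetP[k]; rewrite !inE => ki ->; apply/ltnW/b_top => //; exact/forallP.
by rewrite negb_forall => /existsP[k]; rewrite negbK => /eqP->; exists k => s _.
Qed.

(* Sperner's door argument: a cell is a dominant set with [#|I|] elements, a
   door is a cell minus an element whose remaining colors are all but [i0]. A
   cell without all the colors has an even number of doors, and every door is
   shared by two cells, except the door consisting of the [b i]. *)
Lemma colorful_dominant : exists2 S, dominant S & c @: S = [set: I].
Proof.
pose i0 := c u0.
pose cell (T : {set U}) := dominant T && (#|T| == #|I|).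
pose doors (T : {set U}) := [set x in T | c @: (T :\ x) == [set~ i0]].
case: (pickP (fun T => cell T && odd #|doors T|)) => [T /andP[/andP[TD /eqP TI] oddT]|noT].
  (* If a color were missing, a door [x] of [T] would share its color with exactly one other element
     [y], and [x] and [y] would be the only two doors. *)
  exists T => //; apply/eqP; rewrite eqEsubset subsetT /=; apply/negPn/negP => nT.
  have /set0Pn[x] : doors T != set0 by apply/eqP => e; rewrite e cards0 in oddT.
  rewrite inE => /andP[xT /eqP cx].
  have cTx : #|T :\ x|.+1 = #|I| by rewrite -TI [in RHS](cardsD1 x) xT.
  have cxi : c x != i0.
    apply: contra nT => /eqP e; apply/subsetP => k _; have [->|ki] := eqVneq k i0.
      by rewrite -e imset_f.
    have : k \in [set~ i0] by rewrite !inE.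
    by rewrite -cx => /imsetP[y]; rewrite !inE => /andP[_ yT] ->; exact: imset_f.
  have injD y : c @: (T :\ y) = [set~ i0] -> y \in T -> {in T :\ y &, injective c}.
    move=> e yT; apply/imset_injP; rewrite e cardsC1.
    by rewrite -TI (cardsD1 y) yT.
  have : c x \in [set~ i0] by rewrite !inE.
  rewrite -cx => /imsetP[y yTx cxy].
  have /andP[yx yT] : (y != x) && (y \in T) by move: yTx; rewrite !inE.
  suff e : doors T = [set x; y] by rewrite e cards2 eq_sym yx in oddT.
  apply/setP => z; rewrite !inE; apply/andP/orP => [[zT /eqP cz]|].
    have [_|zx] := eqVneq z x; first by left.
    have [_|zy] := eqVneq z y; first by right.
    case/eqP: yx; apply/esym; apply: (injD z) => //; rewrite !inE ?xT ?yT andbT eq_sym ?zx ?zy //.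
  case=> /eqP ->; first by rewrite xT cx.
  split=> //; rewrite -cx eqEsubset; apply/andP; split; apply/subsetP => k /imsetP[w].
    rewrite !inE => /andP[wy wT] ->; have [->|wx] := eqVneq w x.
      by rewrite cxy imset_f.
    by rewrite imset_f // !inE wx.
  rewrite !inE => /andP[wx wT] ->; have [->|wy] := eqVneq w y.
    by rewrite -cxy imset_f // !inE eq_sym yx xT.
  by rewrite imset_f // !inE wy.
(* Incidences of cells and doors: their number is even when counted by cells, odd when counted by
   doors. *)
pose A := [set p : {set U} * U | cell p.1 & p.2 \in doors p.1].
have evA : ~~ odd #|A|.
  suff ev (T : {set U}) : ~~ odd #|[set p in A | p.1 == T]| by rewrite (@odd_card_fibers _ _ A fst set0).
  have [TC|TC] := boolP (cell T); last first.
    suff -> : [set p in A | p.1 == T] = set0 by rewrite cards0.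
    apply/setP => -[T' x]; rewrite !inE /=; apply/negP => /andP[/andP[TC' _] /eqP e].
    by rewrite e (negbTE TC) in TC'.
  have -> : [set p in A | p.1 == T] = [set (T, x) | x in doors T].
    apply/setP => -[T' x]; rewrite !inE /=; apply/idP/imsetP.
      by move=> /andP[/andP[TC' dx] /eqP e]; rewrite e in dx *; exists x; rewrite ?inE.
    by move=> [y yd [-> ->]]; rewrite eqxx TC andbT; move: yd; rewrite inE.
  rewrite card_imset; last by move=> x y [].
  by have := noT T; rewrite TC /= => ->.
have [fib1 fib2] : (forall S : {set U}, S != b @: [set~ i0] ->
    ~~ odd #|[set p in A | p.1 :\ p.2 == S]|) /\
    odd #|[set p in A | p.1 :\ p.2 == b @: [set~ i0]]|.
  pose ext (S : {set U}) := [set x | (x \notin S) && dominant (x |: S)].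
  have fibE (S : {set U}) : c @: S = [set~ i0] -> #|S|.+1 = #|I| ->
      #|[set p in A | p.1 :\ p.2 == S]| = #|ext S|.
    move=> cS SI; have -> : [set p in A | p.1 :\ p.2 == S] = [set (x |: S, x) | x in ext S].
      apply/setP => -[T x]; rewrite !inE /=; apply/idP/imsetP.
        move=> /andP[/andP[/andP[TD TI] /andP[xT _]] /eqP e].
        by exists x; rewrite ?inE -e setD1K // !inE eqxx.
      move=> [y]; rewrite inE => /andP[yS yD] [-> ->].
      by rewrite setU1K // eqxx andbT /cell yD cardsU1 yS add1n SI cS setU11 !eqxx.
    by rewrite card_imset // => x y [].
  have cb0 : c @: (b @: [set~ i0]) = [set~ i0].
    rewrite -imset_comp -[RHS]imset_id; apply: eq_imset => i /=; exact: cb.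
  have binj : injective b by move=> i j e; rewrite -(cb i) e cb.
  have cardb : #|b @: [set~ i0]|.+1 = #|I|.
    by rewrite card_imset // cardsC1 prednK //; apply/card_gt0P; exists i0.
  split; last by rewrite fibE // card_dominant_ext_bottom.
  move=> S Sb; have [->|] := eqVneq [set p in A | p.1 :\ p.2 == S] set0; first by rewrite cards0.
  case/set0Pn=> -[T x]; rewrite !inE /=.
  move=> /andP[/andP[/andP[TD /eqP TI] /andP[xT /eqP cTx]] /eqP e]; rewrite e in cTx.
  have SI : #|S|.+1 = #|I| by rewrite -e -TI [in RHS](cardsD1 x) xT.
  rewrite fibE // /ext.
  (* A point of the door outside the [b k] makes every [b i] beat the door outside [i], so there are
     two extensions. A door made only of [b k] is determined by its colors, hence is the exceptional
     one. *)
  have [/set0Pn[s]|/negPn allb] := boolP ([set s in S | [forall k, s != b k]] != set0).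
    rewrite inE => /andP[sS /forallP sb]; rewrite card_dominant_ext //.
    - by apply: dominantS TD; rewrite -e subD1set.
    - by apply/set0Pn; exists s.
    move=> i; exists (b i); apply/beatsP => k ki; exists s => //.
    by apply: b_top => //; rewrite eq_sym.
  case/eqP: Sb; have bc s : s \in S -> s = b (c s).
    move=> sS; have : s \notin [set s in S | [forall k, s != b k]] by rewrite (eqP allb) inE.
    by rewrite inE sS /= negb_forall => /existsP[k]; rewrite negbK => /eqP ->; rewrite cb.
  by rewrite -cTx -imset_comp -[LHS]imset_id; apply: eq_in_imset => s /bc.
by move: evA; rewrite (odd_card_fibers (f := fun p => p.1 :\ p.2) fib1) fib2.
Qed.

End DominantSets.

(** Each color [j] receives an extra point [inr j], lowest in order [j] and above all of [X] in the
    others. In a colorful dominant set, the color of an extra point cannot witness dominance at a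
    point of [X], which lies strictly higher. *)
Lemma scarf_lemma (X I : finType) (x0 : X) (c : X -> I) (v : I -> X -> nat) :
  exists D : {set X}, forall y, exists2 i, i \in c @: D &
    forall x, x \in D -> v i y <= v i x.
Proof.
pose N := #|X|.
(* The rank breaks ties, and the successor keeps 0 free for the extra points. *)
pose w i x := (v i x * N + enum_rank x).+1.
have wv i x y : w i x <= w i y -> v i x <= v i y.
  rewrite /w ltnS; have := ltn_ord (enum_rank y).
  rewrite -/N; nia.
have winj i : injective (w i).
  move=> x y [] e; apply/enum_rank_inj/val_inj => /=.
  have hx := ltn_ord (enum_rank x); have hy := ltn_ord (enum_rank y).
  by have := congr1 (modn^~ N) e; rewrite !modnMDl !modn_small.
pose M := \max_(p : I * X) w p.1 p.2.
have wM i x : w i x <= M by exact: (leq_bigmax (F := fun p => w p.1 p.2) (i, x)).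
pose u i (z : X + I) := match z with
  | inl x => w i x
  | inr j => if j == i then 0 else (M + enum_rank j).+1 end.
have uinj i : injective (u i).
  move=> [x|j] [y|k] /=.
  - by move=> /winj ->.
  - by case: eqP => // _; have := wM i x; lia.
  - by case: eqP => // _; have := wM i y; lia.
  case: eqP => [->|_]; case: eqP => [->|_] // -[] /addnI e.
  by congr inr; apply/enum_rank_inj/val_inj.
have [] := @colorful_dominant _ _ u uinj
    (fun z => match z with inl x => c x | inr j => j end) inr (inl x0) => //.
- by move=> i [x|j] /=; rewrite eqxx.
- move=> i j [x|k] ji /= h; last by have := h k; rewrite eqxx.
  by rewrite (negbTE ji) ltnS; have := wM i x; lia.
move=> S /dominantP SD cS; exists [set x | inl x \in S] => y.
have [i hi] := SD (inl y); have : i \in [set: I] by rewrite inE.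
rewrite -cS => /imsetP[[x xS|j jS] ie]; rewrite ie /= in hi.
  exists (c x) => [|z]; first by rewrite imset_f // inE.
  by rewrite inE => /hi; exact: wv.
by have := hi _ jS; rewrite /= eqxx.
Qed.

From mathcomp Require Import all_classical all_reals all_analysis.

Import Order.TTheory GRing.Theory Num.Theory.
Import numFieldNormedType.Exports.

Local Open Scope classical_set_scope.
Local Open Scope ring_scope.

(** * Brouwer's fixed point theorem on a simplex *)

(** A discrete Sperner lemma: after division by [k], each coordinate [i] of [x] is nearly zero or
    [x] is close to a point of color [i]. Scarf's lemma is applied to the coordinate orders. *)
Lemma sperner_grid (n k : nat) (c : {ffun 'I_n -> nat} -> 'I_n) :
  exists2 x : {ffun 'I_n -> nat}, (\sum_i x i)%N = k &
    forall i, (x i < n)%N \/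
      exists y : {ffun 'I_n -> nat}, [/\ (\sum_i y i)%N = k, c y = i &
        forall j, (x j <= y j + n)%N /\ (y j <= x j + n)%N].
Proof.
pose X := {f : {ffun 'I_n -> 'I_k.+1} | (\sum_i f i)%N == k}.
have mkX (f : 'I_n -> nat) : (\sum_i f i)%N = k ->
    exists x : X, forall i, (sval x i : nat) = f i.
  move=> fk; pose g := [ffun i => inord (f i) : 'I_k.+1].
  have gE i : g i = f i :> nat.
    by rewrite ffunE inordK // ltnS -fk (bigD1 i) //= leq_addr.
  have gk : (\sum_i g i)%N == k by apply/eqP; rewrite -[RHS]fk; apply: eq_bigr.
  by exists (exist _ g gk).
pose emb (x : X) : {ffun 'I_n -> nat} := [ffun i => sval x i : nat].
pose i0 := c [ffun=> 0%N].
have sumk (x : X) : (\sum_i sval x i)%N = k by apply/eqP; exact: (valP x).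
have [x0 _] : exists x : X, forall i, (sval x i : nat) = if i == i0 then k else 0%N.
  by apply: mkX; rewrite -big_mkcond big_pred1_eq.
have [D hD] := scarf_lemma x0 (fun x => c (emb x)) (fun i x => sval x i).
have Dx i : exists2 z, z \in D & forall x, x \in D -> (sval z i <= sval x i)%N.
  have [x1 x1D] : exists x, x \in D.
    by have [j /imsetP[x xD _] _] := hD x0; exists x.
  by exists [arg min_(x < x1 | x \in D) sval x i]%N; case: arg_minnP.
pose m i : nat := val (xget x0 [set z | z \in D /\
   forall x, x \in D -> (sval z i <= sval x i)%N]) i.
have mP i : (exists2 z, z \in D & m i = sval z i) /\
    forall x, x \in D -> (m i <= sval x i)%N.
  rewrite /m; case: xgetP => [z _ [zD zm]|]; first by split=> //; exists z.
  by have [z zD zm] := Dx i; move=> /(_ z) [].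
clearbody m.
set C := ((fun x => c (emb x)) @: D)%SET in hD.
(* otherwise the grid has a point larger than [D] in all the coordinates of [C] *)
have large : (k < \sum_(i in C) (m i).+1)%N.
  rewrite ltnNge; apply/negP => small.
  have [j0 j0C _] := hD x0.
  (* The rest of the total [k] goes to one coordinate [j0] of [C]; every coordinate in [C] still
     exceeds its minimum over [D]. *)
  pose f i := (if i \in C then (m i).+1 else 0) + (if i == j0 then k - \sum_(i in C) (m i).+1 else 0)%N.
  have [|y yf] := mkX f.
    rewrite /f big_split /= -big_mkcond /= -big_mkcond /= big_pred1_eq.
    by rewrite subnKC.
  have [i iC hi] := hD y; have [[z zD mz] _] := mP i.
  have := hi _ zD; rewrite -mz yf /f iC; lia.
(* The coordinates of [x] in [C] are at least the minima, whose sum exceeds [k - #|C|]; fewer than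
   [n] units of the total remain. *)
have close (x : X) i : x \in D ->
    (i \in C -> (sval x i < m i + n)%N) /\ (i \notin C -> (sval x i < n)%N).
  move=> xD; have := sumk x; rewrite (bigID (fun j => j \in C)) /= => sx.
  have Cn : (#|C| <= n)%N by rewrite -[X in (_ <= X)%N](card_ord n) max_card.
  have sm : (\sum_(i in C) (m i).+1 = \sum_(i in C) m i + #|C|)%N.
    by rewrite -sum1_card -big_split /=; apply: eq_bigr => j _; rewrite addn1.
  have le1 : (\sum_(i in C) m i <= \sum_(i in C) sval x i)%N.
    by apply: leq_sum => j _; exact: (mP j).2.
  split=> iC.
    move: sx large; rewrite sm (bigD1 i) //= [(\sum_(i in C) m i)%N](bigD1 i) //=.
    have le2 : (\sum_(j in C | j != i) m j <= \sum_(j in C | j != i) sval x j)%N.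
      by apply: leq_sum => j _; exact: (mP j).2.
    move: ((mP i).2 _ xD) le2 Cn.
    have arith p q s t w z : (p <= q -> s <= t -> w <= n -> q + t + z = k ->
        k < p + s + w -> q < p + n)%N by lia.
    exact: arith.
  move: sx large; rewrite sm [X in (_ + X)%N = _](bigD1 i) //= => sx.
  move: sx le1 Cn.
  have arith p q s t w : (p + (q + s) = k -> t <= p -> w <= n -> k < t + w -> q < n)%N by lia.
  exact: arith.
have [j0 /imsetP[x xD _] _] := hD x0.
exists (emb x) => [|i]; first by rewrite -[RHS](sumk x); apply: eq_bigr => i _; rewrite ffunE.
have [iC|iC] := boolP (i \in C); last by left; rewrite ffunE; have [_ ->] := close x i xD.
right; have /imsetP[y yD ->] := iC; exists (emb y); split=> // [|j].
  by rewrite -[RHS](sumk y); apply: eq_bigr => j _; rewrite ffunE.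
rewrite !ffunE; have [hx1 hx2] := close x j xD; have [hy1 hy2] := close y j yD.
have arith1 p q r : (p <= q -> p <= r -> q < p + n -> r < p + n -> q <= r + n /\ r <= q + n)%N.
  by lia.
have arith2 q r : (q < n -> r < n -> q <= r + n /\ r <= q + n)%N by lia.
have [jC|jC] := boolP (j \in C); last by apply: arith2; [exact: hx2|exact: hy2].
by apply: (arith1 (m j)); [exact: (mP j).2|exact: (mP j).2|exact: hx1|exact: hy1].
Qed.

Lemma compact_seq_cluster (R : realType) (T : pseudoMetricType R) (K : set T)
    (u : nat -> T) : compact K -> (forall n, K (u n)) ->
  exists2 z, K z & forall e : R, 0 < e -> forall N, exists2 n, (N <= n)%N & ball z e (u n).
Proof.
move=> cK Ku; have [|z [Kz clz]] := cK (u @ \oo) _; first by exists 0%N => // n _; exact: Ku.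
exists z => // e e0 N; have [] := clz (u @` [set n | (N <= n)%N]) (ball z e).
- by exists N => // n /= Nn; exists n.
- exact: nbhsx_ballx.
by move=> _ [[n /= Nn <-] zn]; exists n.
Qed.

Definition simplex (R : realType) n : set 'rV[R]_n :=
  [set a | (forall i, 0 <= a 0 i) /\ \sum_i a 0 i = 1].

Lemma compact_simplex (R : realType) n : compact (@simplex R n).
Proof.
have cI := @rV_compact R n (fun=> `[0, 1]%classic) (fun=> @segment_compact R 0 1).
have cl : closed [set a : 'rV[R]_n | \sum_i a 0 i = 1].
  apply: (@preimage_closed _ _ (fun a : 'rV[R]_n => \sum_i a 0 i) [set 1]); last exact: closed_eq.
  move=> a _; apply: continuous_big => [|i _]; first exact: add_continuous.
  exact: coord_continuous.
suff -> : @simplex R n = [set v | forall i, `[0, 1]%classic (v 0 i)] `&` [set a | \sum_i a 0 i = 1].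
  exact: compact_closedI.
apply/seteqP; split=> a /= [a0 a1]; split=> // i; last by have := a0 i; rewrite /= in_itv /= => /andP[].
rewrite in_itv /= a0 -a1 (bigD1 i) //= lerDl; exact: sumr_ge0.
Qed.

(** The nearly colorful grid points accumulate at some [a]. For each [i], either [a 0 i = 0] or
    points of color [i] accumulate at [a], so [g] decreases no coordinate of [a]; as both sums are
    1, [g a = a]. *)
Lemma brouwer_simplex (R : realType) n (g : 'rV[R]_n -> 'rV[R]_n) : (0 < n)%N ->
  {within @simplex R n, continuous g} ->
  (forall a, @simplex R n a -> @simplex R n (g a)) -> exists2 a, @simplex R n a & g a = a.
Proof.
move=> n0 cg gS.
pose pt k (x : {ffun 'I_n -> nat}) : 'rV[R]_n := \row_i ((x i)%:R / k.+1%:R).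
have ptS k (x : {ffun 'I_n -> nat}) : (\sum_i x i)%N = k.+1 -> simplex (pt k x).
  move=> xk; split=> [i|]; first by rewrite mxE divr_ge0.
  under eq_bigr do rewrite mxE.
  by rewrite -mulr_suml -natr_sum xk divff // pnatr_eq0.
have colP (a : 'rV[R]_n) : simplex a -> exists i, a 0 i <= g a 0 i.
  move=> aS; apply/not_existsP => h.
  have : \sum_i g a 0 i < \sum_i a 0 i.
    apply: ltr_sum => [|i _]; last by rewrite ltNge; apply/negP/h.
    by apply/hasP; exists (Ordinal n0) => //; rewrite mem_index_enum.
  by rewrite aS.2 (gS _ aS).2 ltxx.
pose col k (x : {ffun 'I_n -> nat}) := xget (Ordinal n0) [set i | pt k x 0 i <= g (pt k x) 0 i].
have colE k (x : {ffun 'I_n -> nat}) : (\sum_i x i)%N = k.+1 -> pt k x 0 (col k x) <= g (pt k x) 0 (col k x).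
  by move=> /ptS/colP[i hi]; rewrite /col; case: xgetP => [//|/(_ i)].
have /choice[x xP] : forall k, exists x : {ffun 'I_n -> nat}, (\sum_i x i)%N = k.+1 /\
    forall i, (x i < n)%N \/
      exists y : {ffun 'I_n -> nat}, [/\ (\sum_i y i)%N = k.+1, col k y = i &
        forall j, (x j <= y j + n)%N /\ (y j <= x j + n)%N].
  by move=> k; have [x ? ?] := sperner_grid k.+1 (col k); exists x.
have [a aS acl] := compact_seq_cluster (u := fun k => pt k (x k)) (@compact_simplex R n)
  (fun k => ptS _ _ (xP k).1).
exists a => //.
have ge i : a 0 i <= g a 0 i.
  rewrite leNgt; apply/negP => lt.
  have a0 : 0 < a 0 i by rewrite (le_lt_trans _ lt) //; exact: (gS _ aS).1.
  have : \forall y \near within (@simplex R n) (nbhs a), 0 < (y : 'rV[R]_n) 0 i - g y 0 i.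
    have h : (fun y : 'rV[R]_n => y 0 i - g y 0 i) @ within (@simplex R n) (nbhs a)
       --> a 0 i - g a 0 i.
      apply: cvgB; first by apply: cvg_within_filter; exact: coord_continuous.
      apply: (@cvg_comp _ _ _ g (fun y : 'rV[R]_n => y 0 i)); last exact: coord_continuous.
      by move/subspace_continuousP : cg; exact.
    apply: (cvgr_gt _ h); by rewrite subr_gt0.
  rewrite near_withinE => /nbhs_ballP[d /= d0 hd].
  (* Half of [d] leaves room for the displacement to the point of color [i]; half of [a 0 i]
     excludes that the coordinate is nearly zero. *)
  pose e := Num.min (d / 2) (a 0 i / 2).
  have e0 : 0 < e by rewrite lt_min !divr_gt0.
  have [N _ hN] : \forall k \near \oo, (n%:R / e < k%:R :> R).
    exact: nbhs_infty_gtr.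
  have [k Nk ak] := acl e e0 N.
  have nk : n%:R / k.+1%:R < e.
    rewrite ltr_pdivrMr // mulrC -ltr_pdivrMr //.
    by apply: lt_trans (hN _ Nk) _; rewrite ltr_nat.
  have [xk xi] := xP k.
  have [xn|[y [yk yi xy]]] := xi i.
    have := ak.2 0 i; rewrite /ball /= mxE.
    have : (x k i)%:R / k.+1%:R < a 0 i / 2.
      apply: (lt_le_trans (lt_trans _ nk)); last by rewrite ge_min lexx orbT.
      by rewrite ltr_pM2r ?invr_gt0 // ltr_nat.
    have : e <= a 0 i / 2 by rewrite ge_min lexx orbT.
    have arith (p q : R) : e <= p / 2 -> q < p / 2 -> p - e < q -> False by lra.
    by rewrite ltr_distlC => h1 h2 /andP[h3 _]; exact: arith h1 h2 h3.
  have := hd (pt k y); have := colE _ _ yk; rewrite yi => h /(_ _ (ptS _ _ yk)).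
  suff : ball a d (pt k y) by move=> aby /(_ aby); lra.
  split=> // i' j; have := ak.2 i' j; rewrite /ball /= !mxE.
  have [/= h1 h2] := xy j.
  have h1' : (x k j)%:R / k.+1%:R <= (y j)%:R / k.+1%:R + n%:R / k.+1%:R :> R.
    by rewrite -mulrDl ler_pM2r ?invr_gt0 // -natrD ler_nat.
  have h2' : (y j)%:R / k.+1%:R <= (x k j)%:R / k.+1%:R + n%:R / k.+1%:R :> R.
    by rewrite -mulrDl ler_pM2r ?invr_gt0 // -natrD ler_nat.
  have : e <= d / 2 by rewrite ge_min lexx.
  have arith (p q q' t : R) : q <= q' + t -> q' <= q + t -> t < e -> e <= d / 2 ->
    p - e < q -> q < p + e -> (p - d < q') && (q' < p + d) by move=> *; apply/andP; lra.
  by rewrite !ltr_distlC => hd2 /andP[h3 h4]; exact: arith h1' h2' nk hd2 h3 h4.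
apply/rowP => i; apply/eqP; rewrite eq_le ge andbT leNgt; apply/negP => lt.
have : \sum_i a 0 i < \sum_i g a 0 i.
  rewrite (bigD1 i) //= [ltRHS](bigD1 i) //= ltr_leD //.
  by apply: ler_sum => j _; exact: ge.
by rewrite aS.2 (gS _ aS).2 ltxx.
Qed.

(** * Schauder's fixed point theorem *)

Lemma convex_set_sum (R : realType) (X : lmodType R) (B : set (convex_lmodType X)) n
    (a : 'I_n -> R) (p : 'I_n -> X) : convex_set B ->
  (forall i, 0 <= a i) -> \sum_i a i = 1 -> (forall i, B (p i)) -> B (\sum_i a i *: p i).
Proof.
move=> cB; elim: n a p => [|n IH] a p a0 a1 Bp.
  by move/eqP: a1; rewrite big_ord0 eq_sym oner_eq0.
pose s := \sum_(i < n) a (lift ord0 i).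
have as1 : a ord0 + s = 1 by rewrite -a1 big_ord_recl.
have s0 : 0 <= s by exact: sumr_ge0.
rewrite big_ord_recl; have [sz|sn] := eqVneq s 0.
  have az i : a (lift ord0 i) = 0.
    by move/psumr_eq0P: sz => /(_ (fun _ _ => a0 _) i isT).
  rewrite big1 => [|i _]; last by rewrite az scale0r.
  by rewrite addr0; move: as1; rewrite sz addr0 => ->; rewrite scale1r.
have Bq : B (\sum_(i < n) (a (lift ord0 i) / s) *: p (lift ord0 i)).
  apply: IH => [i||i] //; first by rewrite divr_ge0.
  by rewrite -mulr_suml divff.
have a01 : a ord0 <= 1 by rewrite -as1 lerDl.
have := cB (p ord0) _ (Itv01 (a0 ord0) a01) (mem_set (Bp _)) (mem_set Bq).
move/set_mem; congr B; congr (_ + _) => /=.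
have -> : unstable.onem (a ord0) = s by rewrite /unstable.onem -as1 addrAC subrr add0r.
rewrite scaler_sumr; apply: eq_bigr => i _.
by rewrite scalerA mulrCA divff // mulr1.
Qed.

Lemma cvg_rV (R : realType) n (T : Type) (F : set_system T) (FF : Filter F)
    (f : T -> 'rV[R]_n) (a : 'rV[R]_n) :
  (forall i, (fun x => f x 0 i) @ F --> a 0 i) -> f @ F --> a.
Proof.
move=> h; apply/cvg_ballP => e e0.
have : \forall x \near F, forall i, ball (a 0 i) e (f x 0 i).
  by apply: filter_forall => i; have /cvg_ballP := h i; exact.
by apply: filterS => x hx; split=> // i j; rewrite (ord1 i).
Qed.

Lemma convex_closed_ball (R : realType) (X : normedModType R) (u : X) (r : R) :
  convex_set (closed_ball_ (@Num.norm R X) u r : set (convex_lmodType X)).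
Proof.
move=> x y t; rewrite !inE /closed_ball_ /= => ux uy.
have t0 : 0 <= t%:num by [].
have s0 : 0 <= 1 - t%:num by rewrite subr_ge0.
have -> : u - (t%:num *: x + (1 - t%:num) *: y) = t%:num *: (u - x) + (1 - t%:num) *: (u - y).
  by rewrite !scalerBr addrACA -scalerDl -opprD [t%:num + _]addrC subrK scale1r.
rewrite (le_trans (ler_normD _ _)) // !normrZ (ger0_norm t0) (ger0_norm s0).
have -> : r = t%:num * r + (1 - t%:num) * r by rewrite -mulrDl [t%:num + _]addrC subrK mul1r.
by rewrite lerD // ler_wpM2l.
Qed.

Lemma compact_net (R : realType) (X : normedModType R) (K : set X) (e : R) :
  compact K -> 0 < e ->
  exists n (p : 'I_n -> X), (forall i, K (p i)) /\
    forall x, K x -> exists i, `|x - p i| < e.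
Proof.
move=> cK e0.
have cK' : cover_compact K by rewrite -compact_cover.
have [|x Kx|D DK cov] := @cK' X K (fun x => ball x e).
- by move=> x _; exact: ball_open.
- by exists x => //; exact: ballxx.
pose L : seq X := finmap.enum_fset D.
exists (size L), (fun i => nth 0 L i); split=> [i|x /cov[y /= yD]].
  by apply: set_mem; apply: DK; exact: mem_nth (ltn_ord i).
have yD' : (index y L < size L)%N by rewrite index_mem.
by rewrite -ball_normE /= distrC => xy; exists (Ordinal yD'); rewrite /= nth_index.
Qed.

(** Schauder projection: a partition of unity [w] subordinate to an [e]-net [p], followed by the
    combination map [c], moves points of [K] by at most [e]. Brouwer's theorem for [w \o T \o c] on
    the simplex of weights gives [a], and [c a] is the desired point. *)
Lemma schauder_approx_fixed_point (R : realType) (X : normedModType R) (B K : set X) (T : X -> X) (e : R) :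
    convex_set (B : set (convex_lmodType X)) -> B !=set0 -> compact K -> K `<=` B ->
    {within B, continuous T} -> (forall x, B x -> K (T x)) -> 0 < e ->
  exists2 x, B x & `|T x - x| <= e.
Proof.
move=> cB [x0 Bx0] cK KB cT TK e0.
have [n [p [Kp pnet]]] := compact_net cK e0.
have n0 : (0 < n)%N by have [i _] := pnet _ (TK _ Bx0); exact: leq_ltn_trans (ltn_ord i).
(* twice the positive part of [e - `|y - p i|] *)
pose f i (y : X) : R := (e - `|y - p i|) + `|e - `|y - p i| |.
have f_ge0 i y : 0 <= f i y.
  by have := ler_norm (- (e - `|y - p i|)); rewrite normrN -subr_ge0 opprK addrC.
have f_gt0 i y : `|y - p i| < e -> 0 < f i y.
  by move=> h; rewrite /f addr_gt0 ?normr_gt0 ?subr_gt0 // gt_eqF ?subr_gt0.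
have f_eq0 i y : e < `|y - p i| -> f i y = 0.
  by move=> h; rewrite /f ler0_norm ?subrr // subr_le0 ltW.
have cf i : continuous (f i).
  have c1 : continuous (fun y => e - `|y - p i|).
    move=> y; apply: cvgB; first exact: cvg_cst.
    by apply: cvg_norm; apply: cvgB; [exact: cvg_id|exact: cvg_cst].
  by move=> y; apply: cvgD; [exact: c1|apply: cvg_norm; exact: c1].
pose s y := \sum_i f i y.
have s_gt0 y : K y -> 0 < s y.
  move=> /pnet[i /f_gt0 fi]; rewrite /s (bigD1 i) //= ltr_pwDl // sumr_ge0 //.
have cs : continuous s.
  by apply: continuous_big => [|i _]; [exact: add_continuous|exact: cf].
pose w y : 'rV[R]_n := \row_i (f i y / s y).
have wS y : K y -> simplex (w y).
  move=> Ky; split=> [i|]; first by rewrite mxE divr_ge0 // ltW // s_gt0.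
  under eq_bigr do rewrite mxE.
  by rewrite -mulr_suml divff // gt_eqF // s_gt0.
have cw y : K y -> w @ y --> w y.
  move=> Ky; apply: cvg_rV => i; rewrite mxE.
  under eq_cvg do rewrite mxE.
  apply: cvgM; first exact: cf.
  by apply: cvgV; [rewrite gt_eqF // s_gt0|exact: cs].
pose c (a : 'rV[R]_n) : X := \sum_i a 0 i *: p i.
have cc : continuous c.
  apply: continuous_big => [|i _]; first exact: add_continuous.
  by move=> a; exact: (cvgZr_tmp (@coord_continuous R 1 n 0 i a)).
have Bc a : simplex a -> B (c a).
  by move=> [a0 a1]; apply: convex_set_sum => // i; exact/KB/Kp.
have [|a /Bc/TK/wS //|a aS aE] := @brouwer_simplex R n (w \o T \o c) n0.
  apply/subspace_continuousP => a aS.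
  apply: (@cvg_comp _ _ _ (T \o c) w); last exact/cw/TK/Bc.
  have cwi : c @ within (@simplex R n) (nbhs a) --> within B (nbhs (c a)).
    move=> V hV.
    have ca : \forall b \near a, B (c b) -> V (c b) by exact: (cc a _ hV).
    suff : \forall b \near a, simplex b -> V (c b) by [].
    by apply: filterS ca => b h /Bc.
  apply: (@cvg_comp _ _ _ c T _ (within B (nbhs (c a)))) => //.
  by move/subspace_continuousP: cT; apply; exact: Bc.
have Bca := Bc _ aS; exists (c a) => //.
set y := T (c a) in aE *; have Ky : K y := TK _ Bca.
have [w0 w1] := wS _ Ky.
(* As [a = w y], the difference is a weighted mean of the [y - p i], and the weight vanishes when
   [|y - p i| > e]. *)
have -> : y - c a = \sum_i w y 0 i *: (y - p i).
  under eq_bigr do rewrite scalerBr.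
  by rewrite sumrB -scaler_suml w1 scale1r -[in LHS]aE.
apply: le_trans (ler_norm_sum _ _ _) _; rewrite -[leRHS]mul1r -w1 mulr_suml.
apply: ler_sum => i _; rewrite normrZ (ger0_norm (w0 i)).
have [ye|ye] := leP `|y - p i| e; first by rewrite ler_wpM2l.
by rewrite mxE f_eq0 // !mul0r.
Qed.

(** The images of approximate fixed points accumulate at some [z] in [K]; so do the points
    themselves, and continuity at [z] concludes. *)
Theorem schauder_fixed_point (R : realType) (X : normedModType R) (B K : set X) (T : X -> X) :
    convex_set (B : set (convex_lmodType X)) -> B !=set0 -> compact K -> K `<=` B ->
    {within B, continuous T} -> (forall x, B x -> K (T x)) ->
  exists2 x, B x & T x = x.
Proof.
move=> cB B0 cK KB cT TK.
have /choice[x xP] : forall k : nat, exists x, B x /\ `|T x - x| <= k.+1%:R^-1.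
  move=> k; have k0 : 0 < (k.+1%:R^-1 : R) by rewrite invr_gt0.
  have [x Bx xT] := schauder_approx_fixed_point cB B0 cK KB cT TK k0.
  by exists x.
have [z Kz zP] := compact_seq_cluster cK (fun k => TK _ (xP k).1).
exists z; first exact: KB.
apply/eqP; rewrite -subr_eq0 -normr_le0; apply/ler_addgt0Pl => e e0; rewrite addr0.
have e20 : 0 < e / 2 by rewrite divr_gt0.
move/subspace_continuousP : cT => /(_ z (KB _ Kz))/cvgrPdist_lt/(_ _ e20).
rewrite near_withinE => /nbhs_ballP[d /= d0 hd].
(* Two distances below [d / 2] bring [x k] within [d] of [z]; [e / 2] bounds the distance from
   [T (x k)] to [z]. *)
pose m := Num.min (d / 2) (e / 2).
have m0 : 0 < m by rewrite lt_min !divr_gt0.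
have [N _ hN] : \forall k \near \oo, (m^-1 < k%:R :> R) by exact: nbhs_infty_gtr.
have [k Nk] := zP m m0 N; rewrite -ball_normE /= => zTx.
have [Bx xT] := xP k.
have km : k.+1%:R^-1 < m.
  rewrite -[ltRHS]invrK ltf_pV2 ?posrE ?invr_gt0 //.
  by apply: lt_trans (hN _ Nk) _; rewrite ltr_nat.
have md : m <= d / 2 by rewrite ge_min lexx.
have me : m <= e / 2 by rewrite ge_min lexx orbT.
have zx : `|z - x k| < d.
  rewrite -(subrK (T (x k)) z) -addrA (le_lt_trans (ler_normD _ _)) //.
  have arith (p q t : R) : p < m -> q <= t -> t < m -> p + q < d by lra.
  exact: arith zTx xT km.
have := hd (x k); rewrite -ball_normE => /(_ zx Bx) /= Tzx.
rewrite -(subrK (T (x k)) (T z)) -addrA (le_trans (ler_normD _ _)) //.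
rewrite distrC in zTx.
have arith (p q : R) : p < e / 2 -> q < m -> p + q <= e by lra.
exact: arith Tzx zTx.
Qed.

(** * Compact perturbations of the identity *)

Section CompactPerturbation.
Variables (R : realType) (X : normedModType R) (K : {linear X -> X}) (C : set X) (c : R).
Hypotheses (cK : continuous K) (cC : compact C) (KC : forall x, `|x| <= 1 -> C (K x)).
Hypothesis c_ge0 : 0 <= c.
Let L x := x - K x.
Hypothesis L_below : forall x, `|x| <= c * `|L x|.

Let LB x y : L (x - y) = L x - L y.
Proof. by rewrite /L linearB !opprB addrACA [RHS]addrACA [- K x + _]addrC. Qed.

Let LD x y : L (x + y) = L x + L y.
Proof. by rewrite /L linearD opprD addrACA. Qed.

Let LZ a x : L (a *: x) = a *: L x.
Proof. by rewrite /L linearZ scalerBr. Qed.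

(** Approximate preimages [z n] are bounded because [L] is bounded below, so the [K (z n)] have a
    cluster point. Adding it to [y] gives a cluster point of [z n = L (z n) + K (z n)], which is a
    preimage. *)
Lemma closed_range_compact_perturbation y :
  (forall e, 0 < e -> exists z, `|y - L z| < e) -> exists x, L x = y.
Proof.
move=> hy; have [k k0 Kk] := linear_lipschitz cK.
have L_le v : `|L v| <= (1 + k) * `|v|.
  by rewrite /L (le_trans (ler_normB _ _)) // mulrDl mul1r lerD2l.
have /choice[z zP] : forall n : nat, exists z, `|y - L z| < n.+1%:R^-1.
  by move=> n; apply: hy; rewrite invr_gt0.
(* A bound for the [z n], since [|L (z n)| <= |y| + 1]; the last 1 makes it positive. *)
pose b := c * (`|y| + 1) + 1.
have b0 : 0 < b by rewrite /b ltr_wpDl // mulr_ge0 // addr_ge0.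
have zb n : `|b^-1 *: z n| <= 1.
  rewrite normrZ normfV (gtr0_norm b0) mulrC ler_pdivrMr // mul1r.
  apply: (le_trans (L_below _)); rewrite /b.
  apply: (@le_trans _ _ (c * (`|y| + 1))); last by rewrite lerDl.
  rewrite ler_wpM2l // -[L _](subKr y) (le_trans (ler_normB _ _)) // lerD2l.
  by rewrite (le_trans (ltW (zP n))) // invf_le1 // ler1n.
have [w Cw wP] := compact_seq_cluster cC (fun n => KC (zb n)).
exists (y + b *: w); apply/eqP; rewrite -subr_eq0 -normr_le0.
apply/ler_addgt0Pl => e e0; rewrite addr0.
pose q := (1 + k) * (1 + b) + 1.
have q0 : 0 < q by rewrite /q ltr_wpDl // mulr_ge0 // addr_ge0 // ltW.
pose m := e / q.
have m0 : 0 < m by rewrite divr_gt0.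
have [N _ hN] : \forall n \near \oo, (m^-1 < n%:R :> R) by exact: nbhs_infty_gtr.
have [n Nn] := wP m m0 N; rewrite -ball_normE /= => wn.
have nm : n.+1%:R^-1 < m.
  rewrite -[ltRHS]invrK ltf_pV2 ?posrE ?invr_gt0 //.
  by apply: lt_trans (hN _ Nn) _; rewrite ltr_nat.
set x := y + b *: w.
have xz : `|x - z n| <= m + b * m.
  have -> : x - z n = (y - L (z n)) + b *: (w - K (b^-1 *: z n)).
    rewrite linearZ /= scalerBr scalerA divff ?gt_eqF // scale1r /L /x.
    by rewrite opprB addrACA [_ - z n - _]addrAC subrr add0r.
  rewrite (le_trans (ler_normD _ _)) // lerD //; first exact: ltW (lt_trans (zP n) nm).
  by rewrite normrZ (gtr0_norm b0) ler_pM2l // ltW.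
have -> : L x - y = L (x - z n) - (y - L (z n)).
  have cancel (f g h : X) : f - h = f - g - (h - g) by rewrite opprB addrA subrK.
  by rewrite LB; exact: cancel.
rewrite (le_trans (ler_normB _ _)) //.
have -> : e = (1 + k) * (m + b * m) + m.
  by rewrite -[e in LHS](divfK (lt0r_neq0 q0)) -/m /q; ring.
rewrite lerD //; last exact: ltW (lt_trans (zP n) nm).
by rewrite (le_trans (L_le _)) // ler_pM2l // addr_gt0.
Qed.

(* Otherwise the ranges of the powers of [L] decrease strictly, and Riesz's
   almost orthogonal unit vectors [x_n] in the range of [L^n] have images under
   [K] at mutual distance at least 1/2. *)
Lemma surjective_compact_perturbation y : exists x, L x = y.
Proof.
apply: contrapT => ny.
have [d d0 dP] : exists2 d : R, 0 < d & forall z, d <= `|y - L z|.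
  apply: contrapT => h; have [|x Lx] := @closed_range_compact_perturbation y; last by apply: ny; exists x.
  move=> e e0; apply: contrapT => nz; apply: h; exists e => // z.
  by rewrite leNgt; apply/negP => ze; apply: nz; exists z.
have iB n u v : iter n L (u - v) = iter n L u - iter n L v.
  by elim: n => //= n ->; rewrite LB.
have iD n u v : iter n L (u + v) = iter n L u + iter n L v.
  by elim: n => //= n ->; rewrite LD.
have iZ n a u : iter n L (a *: u) = a *: iter n L u.
  by elim: n => //= n ->; rewrite LZ.
have below n v : `|v| <= c ^+ n * `|iter n L v|.
  elim: n => [|n IH]; first by rewrite expr0 mul1r.
  by rewrite (le_trans IH) // exprSr -mulrA ler_wpM2l // exprn_ge0.
(* Near-minimizers of the distance from [L^n y] to the range of [L^(n+1)], normalized. The distance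
   is positive because [L] is bounded below and [y] is at distance at least [d] from its range. *)
have riesz n : exists a, `|iter n L a| <= 1 /\ forall w, 2^-1 <= `|iter n L a - iter n.+1 L w|.
  pose v z := iter n L (y - L z).
  have vE z : v z = iter n L y - iter n.+1 L z by rewrite /v iB iterSr.
  have vpos z : 0 < `|v z|.
    rewrite normr_gt0; apply/eqP => vz; have := below n (y - L z).
    rewrite -/(v z) vz normr0 mulr0 => h; have := lt_le_trans d0 (dP z).
    by rewrite ltNge h.
  pose S := [set `|v z| | z in [set: X]].
  have Slb t : S t -> 0 <= t by move=> [z _ <-].
  have infS : has_inf S by split; [exists `|v 0|; exists 0|exists 0].
  have D0 : 0 < inf S.
    have cd z : d <= c ^+ n * `|v z| by rewrite (le_trans (dP z)) //; exact: below.
    have cn0 : 0 < c ^+ n.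
      rewrite lt_neqAle exprn_ge0 // andbT eq_sym; apply/eqP => e.
      by have := cd 0; rewrite e mul0r leNgt d0.
    apply: (@lt_le_trans _ _ (d / c ^+ n)); first by rewrite divr_gt0.
    apply: lb_le_inf; first by exists `|v 0|; exists 0.
    by move=> _ [z _ <-]; rewrite ler_pdivrMr // mulrC.
  (* The slack [inf S] gives [|v z| < 2 * inf S], whence the constant 1/2. *)
  have [_ [z _ <-] vz] := inf_adherent D0 infS.
  exists (`|v z|^-1 *: (y - L z)); rewrite iZ -/(v z); split=> [|w].
    by rewrite normrZ normfV normr_id mulVf // gt_eqF.
  have -> : `|v z|^-1 *: v z - iter n.+1 L w = `|v z|^-1 *: v (z + `|v z| *: w).
    have -> : v (z + `|v z| *: w) = v z - `|v z| *: iter n.+1 L w.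
      by rewrite !vE -addrA -opprD; congr (_ - _); rewrite iD iZ.
    by rewrite scalerBr scalerA mulVf ?gt_eqF // scale1r.
  rewrite normrZ normfV normr_id mulrC ler_pdivlMr //.
  have : inf S <= `|v (z + `|v z| *: w)| by apply: ge_inf; [exact: infS.2|exists (z + `|v z| *: w)].
  lra.
have /choice[a aP] := riesz.
have [z Cz zP] := compact_seq_cluster cC (fun n => KC (aP n).1).
have q0 : 0 < (4^-1 : R) by rewrite invr_gt0.
have [n _ zn] := zP _ q0 0%N; have [m nm zm] := zP _ q0 n.+1.
set xn := iter n L (a n) in zn; set xm := iter m L (a m) in zm.
have xmE : xm = iter n.+1 L (iter (m - n.+1) L (a m)) by rewrite -iterD subnKC.
(* This argument of [L^(n+1)] turns the difference into [K xn - K xm], whose terms are both within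
   1/4 of [z]. *)
have := (aP n).2 (a n + iter (m - n.+1) L (a m) - L (iter (m - n.+1) L (a m))).
suff -> : iter n L (a n) - iter n.+1 L (a n + iter (m - n.+1) L (a m) - L (iter (m - n.+1) L (a m))) = K xn - K xm.
  rewrite leNgt -(subrK z (K xn)) -addrA => /negP; apply.
  move: zn zm; rewrite -!ball_normE /= distrC => zn zm.
  rewrite (le_lt_trans (ler_normD _ _)) //; lra.
have KE x : K x = x - L x by rewrite /L subKr.
set t := iter (m - n.+1) L (a m) in xmE *.
rewrite iB iD -[iter n.+1 L (L t)]iterSr [iter n.+2 L t]iterS -xmE !KE.
by rewrite -[_ + xm - _]addrA opprD addrA.
Qed.

End CompactPerturbation.

(** * Approximation of a fixed point *)

Lemma differentiable_remainder (R : realType) (V W : normedModType R) (f : V -> W) (x : V) :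
  differentiable f x -> forall d : R, 0 < d -> exists2 e : R, 0 < e &
    forall y, `|y - x| < e -> `|f y - f x - 'd f x (y - x)| <= d * `|y - x|.
Proof.
move=> /diff_locally/eqaddoP df d d0.
have /nbhs_ballP[e /= e0 he] := df d d0; exists e => // y ye.
have := he (y - x); rewrite -ball_normE /= sub0r normrN => /(_ ye).
rewrite /= !fctE /=.
by rewrite subrK opprD addrA.
Qed.

(** Rescaling [x] to norm [r] makes it an admissible displacement, and homogeneity cancels the
    factor. If [D x = 0] and [N x != 0], the quotient would be +oo, against the finite bound. *)
Lemma sup_ratio_le (R : realType) (X : normedModType R) (N D : X -> X) (u : X) (r M : R) :
    0 < r -> (forall a x, N (a *: x) = a *: N x) -> (forall a x, D (a *: x) = a *: D x) ->
  (sup_ratio N D u r <= M%:E)%E -> forall x, `|N x| <= M * `|D x|.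
Proof.
move=> r0 NZ DZ supM x; have [->|x0] := eqVneq x 0.
  by rewrite -(scale0r 0) NZ DZ !scale0r !normr0 mulr0.
pose t := r / `|x|.
have nx0 : 0 < `|x| by rewrite normr_gt0.
have t0 : 0 < t by rewrite divr_gt0.
have : (`|N (t *: x)|%:E / `|D (t *: x)|%:E <= M%:E)%E.
  apply: le_trans supM; apply: ereal_sup_ubound; exists (t *: x) => //; split.
    by rewrite scaler_eq0 negb_or gt_eqF.
  rewrite /closed_ball_ /= opprD addNKr normrN normrZ (gtr0_norm t0).
  by rewrite divfK // gt_eqF.
rewrite NZ DZ !(normrZ t) (gtr0_norm t0) inver.
case: ifPn => [|Dx].
  rewrite mulf_eq0 gt_eqF //= normr_eq0 => /eqP ->; rewrite normr0 mulr0.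
  have [Nx|Nx] := eqVneq (N x) 0; first by rewrite Nx normr0.
  have tN : 0 < t * `|N x| by rewrite mulr_gt0 ?normr_gt0.
  by rewrite gt0_muley ?lte_fin.
rewrite -EFinM lee_fin; rewrite mulf_eq0 negb_or in Dx.
have [_ Dx0] := andP Dx.
rewrite ler_pdivrMr; last by rewrite mulr_gt0 // lt_neqAle eq_sym Dx0 normr_ge0.
by rewrite mulrCA ler_pM2l.
Qed.

(** The limit point supplies [h0] in [H], different from [hoo], inside an interval around [hoo] on
    which [P] holds along [H]; the interval contains everything between [h0] and [hoo]. *)
Lemma limit_point_between (R : realType) (hoo : \bar R) (H P : set R) :
  limit_point [set h%:E | h in H] hoo -> within H (param_nbhs hoo) P ->
  exists h0 : R, [/\ H h0, h0%:E != hoo &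
    forall h, H h -> between h0%:E hoo h -> P h].
Proof.
case: hoo => [l||] lim.
- rewrite /within /= => /nbhs_ballP[d /= d0 hd].
  have [|y [yl [h0 Hh0 h0y] [h lh hy]]] := lim [set x | exists2 h : R, ball l d h & h%:E = x].
    have : \forall h \near l, ball l d h by exact: nbhsx_ballx.
    by apply: (@filterS _ (nbhs l)) => h lh; exists h.
  rewrite -{y}h0y in yl hy; move: hy lh => [->] lh0.
  exists h0; split=> // k Hk hk; apply: hd => //; last first.
    by apply/eqP => kl; case: hk; rewrite kl ltxx ?andbF.
  move: lh0; rewrite -!ball_normE /= !ltr_distlC => /andP[h1 h2].
  by case: hk; rewrite !lte_fin => /andP[h3 h4]; apply/andP; split; lra.
- move=> [M [_ hM]].
  have [|y [yl [h0 Hh0 h0y] /= My]] := lim [set x | (M%:E < x)%E].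
    by exists M; rewrite num_real.
  rewrite -{y}h0y in yl My.
  exists h0; split=> // h Hh [/andP[h0h _]|/andP[]]; last by rewrite ltNge leey.
  by apply: hM => //; rewrite -lte_fin (lt_trans My).
- move=> [M [_ hM]].
  have [|y [yl [h0 Hh0 h0y] /= My]] := lim [set x | (x < M%:E)%E].
    by exists M; rewrite num_real.
  rewrite -{y}h0y in yl My.
  exists h0; split=> // h Hh [/andP[_]|/andP[_ h0h]]; first by rewrite ltNge leNye.
  by apply: hM => //; rewrite -lte_fin (lt_trans _ My).
Qed.

Unset Implicit Arguments.
Set Strict Implicit.
Set Printing Implicit Defensive.

Theorem theorem2p3 (R : realType) (X Y : completeNormedModType R)
    (iota : {linear X -> Y}) (hiota : compact_embedding iota)
    (A : Y -> X) (hA : continuous A)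
    (u : X) (hu : A (iota u) = u)
    (hoo : \bar R)
    (H : set R) (hH : limit_point [set h%:E | h in H] hoo)
    (Xh : R -> submodClosed X)
    (Ah : R -> Y -> X)
    (hAh : forall h, H h -> h%:E != hoo ->
       continuous (Ah h) /\ forall y, Ah h y \in Xh h)
    (hdiff : differentiable A (iota u))
    (r : R) (hr : 0 < r) (M0 M1 : R) (hM0 : 0 <= M0) (hM1 : 0 <= M1)
    (hsup0 : (sup_ratio (fun w : X => w - 'd A (iota u) (iota w))%R id u r
              <= M0%:E)%E)
    (hsup1 : (sup_ratio id (fun w : X => w - 'd A (iota u) (iota w))%R u r
              <= M1%:E)%E)
    (heps : local_error iota A (Ah h) u r
              @[h --> within H (param_nbhs hoo)] --> 0%E) :
  exists r0 h0 : R,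
    [/\ 0 < r0, r0 <= (1 + M0 * M1)^-1 * r, H h0, h0%:E != hoo &
      forall h, H h -> between h0%:E hoo h ->
        exists uh : X,
          [/\ uh \in Xh h, Ah h (iota uh) = uh,
              closed_ball_ (@Num.norm R X) u r0 uh,
              `|uh - u| <= 2 * M1 * `|Ah h (iota uh) - A (iota uh)| &
              2 * M1 * `|Ah h (iota uh) - A (iota uh)|
                <= (1 + 2 * M0 * M1) * `|uh - u|]].
Proof.
have [iota_inj iota_cont iota_cpt] := hiota.
pose D : {linear Y -> X} := 'd A (iota u).
have D_cont : continuous D by exact: diff_continuous.
pose K : {linear X -> X} := (D \o iota : {linear X -> X}).
have K_cont : continuous K by move=> x; apply: continuous_comp; [exact: iota_cont|exact: D_cont].
pose L x := x - K x.
have LB x y : L (x - y) = L x - L y.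
  by rewrite /L linearB !opprB addrACA [RHS]addrACA [- K x + _]addrC.
have LZ a x : L (a *: x) = a *: L x by rewrite /L linearZ scalerBr.
have L_above x : `|L x| <= M0 * `|x| by exact: (sup_ratio_le hr _ _ hsup0).
have L_below x : `|x| <= M1 * `|L x| by exact: (sup_ratio_le hr _ _ hsup1).
have iota_bounded (v : X) s : bounded_set (closed_ball_ (@Num.norm R X) v s).
  exists (`|v| + s); split; first exact: num_real.
  move=> x vx y; rewrite /closed_ball_ /= distrC => yv.
  by rewrite -(subrK v y) (le_trans (ler_normD _ _)) // (le_trans _ (ltW vx)) // addrC lerD2l.
(* Continuous maps on [Y] become compact on [X] through the embedding. This serves [D] in the Riesz
   theory and [G] in Schauder's theorem. *)
have cpt (G : Y -> X) v s : continuous G ->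
    exists2 C : set X, compact C & forall x, `|v - x| <= s -> C (G (iota x)).
  move=> cG; have := iota_cpt _ (iota_bounded v s); rewrite precompactE => cB.
  exists (G @` closure (iota @` closed_ball_ (@Num.norm R X) v s)) => [|x vx].
    by apply: continuous_compact => //; exact: continuous_subspaceT.
  by exists (iota x) => //; apply: subset_closure; exists x.
have /choice[S LS] : forall y, exists x, L x = y.
  have [C cC KC] := cpt D 0 1 D_cont.
  move=> y; apply: (surjective_compact_perturbation K_cont cC _ hM1 L_below) => x x1.
  by apply: KC; rewrite sub0r normrN.
have S_lip x y : `|S x - S y| <= M1 * `|x - y|.
  by rewrite (le_trans (L_below _)) // LB !LS.
have S_cont : continuous S.
  move=> x; apply/cvgrPdist_lt => e e0.
  have d0 : 0 < e / (M1 + 1) by rewrite divr_gt0 // ltr_wpDl.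
  have : \forall y \near x, `|x - y| < e / (M1 + 1).
    by have /cvgrPdist_lt/(_ _ d0) := @cvg_id _ (nbhs x).
  apply: filterS => y xy; rewrite (le_lt_trans (S_lip _ _)) //.
  rewrite ltr_pdivlMr ?ltr_wpDl // in xy; apply: le_lt_trans xy.
  by rewrite mulrC ler_wpM2l // lerDl.
have [ci ci0 iota_le] := linear_lipschitz iota_cont.
(* Chosen to have [M1 * d * ci <= 1 / 4]; the added 1 covers [M1 = 0]. *)
pose d := (4 * (M1 * ci + 1))^-1.
have M1ci : 0 <= M1 * ci by rewrite mulr_ge0 // ltW.
have d0 : 0 < d by rewrite invr_gt0 mulr_gt0 // ltr_wpDl.
have M1d : M1 * (d * ci) <= 4^-1.
  rewrite mulrCA mulrC ler_pdivrMr ?mulr_gt0 ?ltr_wpDl // mulrA mulVf // mul1r.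
  by rewrite lerDl.
have dci : 0 <= d * ci by rewrite mulr_ge0 // ltW.
have [rho rho0 rem] := differentiable_remainder hdiff d0.
have M01 : 0 < 1 + M0 * M1 by rewrite ltr_pwDl // mulr_ge0.
(* The second bound keeps [iota v] within [rho] of [iota u], strictly because of the factor 2. *)
pose r0 := Num.min ((1 + M0 * M1)^-1 * r) (rho / (2 * ci)).
have r00 : 0 < r0 by rewrite lt_min mulr_gt0 ?invr_gt0 //= divr_gt0 // mulr_gt0.
have r0r : r0 <= r.
  rewrite (@le_trans _ _ ((1 + M0 * M1)^-1 * r)) ?ge_min ?lexx //.
  rewrite -[leRHS]mul1r ler_pM2r // invf_le1 // lerDl mulr_ge0 //.
have remX v : `|u - v| <= r0 -> `|A (iota v) - u - K (v - u)| <= d * ci * `|v - u|.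
  move=> uv; have iv : `|iota v - iota u| <= ci * `|v - u| by rewrite -linearB iota_le.
  have := rem (iota v); rewrite hu -[iota v - iota u]linearB => h.
  apply: (le_trans (h _)); last by rewrite -mulrA ler_pM2l // linearB.
  rewrite linearB (le_lt_trans iv) // distrC.
  rewrite (@le_lt_trans _ _ (ci * (rho / (2 * ci)))) //.
    by rewrite ler_pM2l // (le_trans uv) // ge_min lexx orbT.
  have -> : ci * (rho / (2 * ci)) = rho / 2 by field; rewrite gt_eqF.
  by rewrite ltr_pdivrMr // ltr_pMr // ltr1n.
(* A discretization error up to [eta] becomes at most [r0 / 4] under the [M1]-Lipschitz inverse
   [S]. *)
pose eta := r0 / (4 * (M1 + 1)).
have eta0 : 0 < eta by rewrite divr_gt0 // mulr_gt0 // ltr_wpDl.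
have M1eta : M1 * eta <= r0 / 4.
  have -> : r0 / 4 = (M1 + 1) * eta by rewrite /eta; field; rewrite gt_eqF // ltr_wpDl.
  by rewrite ler_pM2r // lerDl.
(* Splitting into the discretization error [a - b] and the linearization remainder about [e]. *)
have zid (a b k l e : X) : a - k - (e - l) = a - b + (b - e - (k - l)).
  have -> : a - b + (b - e - (k - l)) = a - e - (k - l) by rewrite addrA [a - b + _]addrA subrK.
  by rewrite !opprB addrACA [RHS]addrACA [- k + _]addrC.
have small : within H (param_nbhs hoo) [set h | (local_error iota A (Ah h) u r < eta%:E)%E].
  have eta_nbhs : nbhs (0%E : \bar R) [set x | (x < eta%:E)%E].
    by apply: open_ereal_lt'; rewrite lte_fin.
  exact: (heps _ eta_nbhs).
have [h0 [Hh0 h0oo h0P]] := limit_point_between hH small.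
exists r0, h0; split=> // [|h Hh hb]; first by rewrite ge_min lexx.
have hoo' : h%:E != hoo by apply/eqP => e; case: hb; rewrite e ltxx ?andbF.
have [Ah_cont Ah_Xh] := hAh h Hh hoo'.
have Ah_close v : `|u - v| <= r -> `|Ah h (iota v) - A (iota v)| <= eta.
  move=> uv; rewrite -lee_fin; apply: le_trans (ltW (h0P h Hh hb)).
  by apply: ereal_sup_ubound; exists v.
pose G y := S (Ah h y - D y).
have G_cont : continuous G.
  move=> y; apply: (@continuous_comp _ _ _ (fun y => Ah h y - D y) S); last exact: S_cont.
  by apply: cvgB; [exact: Ah_cont|exact: D_cont].
pose B := closed_ball_ (@Num.norm R X) u r0.
have GB v : B v -> B (G (iota v)).
  rewrite /B /closed_ball_ /= => uv; rewrite distrC.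
  rewrite (le_trans (L_below _)) // LB LS (zid _ (A (iota v))).
  (* The discretization error and the remainder each contribute at most [r0 / 4]. *)
  apply: (@le_trans _ _ (M1 * (eta + d * ci * r0))).
    rewrite ler_wpM2l // (le_trans (ler_normD _ _)) // lerD //.
      by rewrite Ah_close // (le_trans uv).
    rewrite -[D (iota v)]/(K v) -linearB (le_trans (remX _ uv)) //.
    by rewrite distrC ler_wpM2l.
  have := ler_wpM2r (ltW r00) M1d.
  have arith (p q s : R) : p * q <= s / 4 -> p * (d * ci) * s <= 4^-1 * s -> 0 < s ->
    p * (q + d * ci * s) <= s by lra.
  by move=> hr0; exact: arith M1eta hr0 r00.
have [C cC GC] := cpt G u r0 G_cont.
have [||||||x Bx Gx] := @schauder_fixed_point R X B (C `&` B) (G \o iota).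
- exact: convex_closed_ball.
- by exists u; rewrite /B /closed_ball_ /= subrr normr0 ltW.
- apply: compact_closedI => //; exact: closed_closed_ball_.
- by move=> x [].
- apply: continuous_subspaceT => x; apply: continuous_comp; [exact: iota_cont|exact: G_cont].
- by move=> x Bx; split; [exact: GC|exact: GB].
have Ax : Ah h (iota x) = x.
  have := congr1 L Gx; rewrite /= LS /L -[K x]/(D (iota x)).
  by move/(congr1 (+%R^~ (D (iota x)))); rewrite !subrK.
set e := `|Ah h (iota x) - A (iota x)|.
set rem_x := A (iota x) - u - K (x - u).
have Lxu : L (x - u) = (Ah h (iota x) - A (iota x)) + rem_x.
  rewrite /rem_x [K (x - u)]linearB -zid Ax LB //.
have rem_le : `|rem_x| <= d * ci * `|x - u| by exact: remX.
have M1rem : M1 * `|rem_x| <= 4^-1 * `|x - u|.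
  rewrite (le_trans (ler_wpM2l hM1 rem_le)) // mulrA.
  by rewrite ler_wpM2r.
exists x; split=> //; first by rewrite -Ax Ah_Xh.
(* The remainder accounts for at most a quarter of [|x - u|], which leaves the factor 4/3, below
   2. *)
- have below : `|x - u| <= M1 * e + M1 * `|rem_x|.
    rewrite (le_trans (L_below _)) // -mulrDr ler_wpM2l //.
    by rewrite Lxu (le_trans (ler_normD _ _)).
  have arith (p q t : R) : t <= p + q -> q <= 4^-1 * t -> 0 <= p -> t <= 2 * p by lra.
  by rewrite -mulrA; apply: (arith _ _ _ below M1rem); rewrite mulr_ge0 // normr_ge0.
(* After doubling, the remainder contributes at most half of [|x - u|], within the summand 1 of the
   constant. *)
- have above : e <= M0 * `|x - u| + `|rem_x|.
    have -> : e = `|L (x - u) - rem_x| by rewrite Lxu addrK.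
    by rewrite (le_trans (ler_normB _ _)) // lerD2r.
  have arith (p q m : R) : p <= M1 * (M0 * m) + q -> q <= 4^-1 * m -> 0 <= m ->
    2 * p <= (1 + 2 * M0 * M1) * m by lra.
  rewrite -mulrA; apply: arith _ M1rem (normr_ge0 _).
  by rewrite (le_trans (ler_wpM2l hM1 above)) // mulrDr.
Qed.
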